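(* Let $\mathcal{X}$ be a separable real Hilbert space, let $d\ge 1$ be an integer, let $\phi_1,\dots,\phi_n\in\mathcal{X}$, and let $\tilde\psi_1,\dots,\tilde\psi_n\in\mathcal{X}$ be points such that $\operatorname{span}\{\tilde\psi_1,\dots,\tilde\psi_n\}=\operatorname{span}\{\phi_1,\dots,\phi_n\}$. For each $i$ define $$\tilde\varphi_i=\big(\langle\phi_i,\tilde\psi_1\rangle,\dots,\langle\phi_i,\tilde\psi_n\rangle\big)^T\in\mathbb{R}^n .$$ Let $f:\mathbb{R}^{n\times n}\to\mathbb{R}$ be any function. Then the optimization problem $$\min_{A}\ f\big((\langle A\phi_i,A\phi_j\rangle)_{1\le i,j\le n}\big)\quad\text{subject to } A:\mathcal{X}\to\mathbb{R}^d\text{ being a bounded linear map}$$ has the same optimal value as the optimization problem $$\min_{A'\in\mathbb{R}^{d\times n}}\ f\big((\tilde\varphi_i^T A'^T A'\tilde\varphi_j)_{1\le i,j\le n}\big).$$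
   Context: All Hilbert spaces are over $\mathbb{R}$; $\mathbb{R}^d$ carries the standard inner product. The ''optimal value'' of a minimization problem is the infimum (in $[-\infty,\infty)$) of the objective function over the feasible set. The function $f$ represents an objective function that depends on $A$ only through the inner products $\langle A\phi_i,A\phi_j\rangle$, $1\le i,j\le n$. *)

(* Defs.v *)
(* The real field is an arbitrary [R : realType]. *)
From HB Require Import structures.
From mathcomp Require Import all_boot all_order all_algebra.
From mathcomp Require Import all_classical all_reals all_analysis.

Set Implicit Arguments.
Unset Strict Implicit.
Unset Printing Implicit Defensive.

Import Order.TTheory GRing.Theory Num.Theory.
Import numFieldNormedType.Exports.

Local Open Scope classical_set_scope.
Local Open Scope ring_scope.

(* With this predicate, a real Hilbert space is a complete normed space [X]
   together with a symmetric positive definite form [ip] inducing its norm. *)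
Definition induces_norm (R : realType) (X : completeNormedModType R)
    (ip : {dot X for idfun}) : Prop :=
  forall x : X, `|x| = Num.sqrt (ip x x).

Definition separable_space (T : topologicalType) : Prop :=
  exists2 S : set T, countable S & dense S.

(* [vector.span] is restricted to finite-dimensional spaces. *)
Definition lin_span (R : realType) (X : lmodType R) (n : nat)
    (v : 'I_n -> X) : set X :=
  [set x | exists c : 'I_n -> R, x = \sum_(i < n) c i *: v i].

Definition dotv (R : realType) (d : nat) (u v : 'cV[R]_d) : R :=
  \sum_(k < d) u k 0 * v k 0.

(* The library norm on ['cV[R]_d] is the sup norm, so the Euclidean norm is
   spelled out. *)
Definition bounded_linear_map (R : realType) (X : normedModType R) (d : nat)
    (A : {linear X -> 'cV[R]_d}) : Prop :=
  exists C : R, forall x : X, Num.sqrt (dotv (A x) (A x)) <= C * `|x|.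

(* The optimal value lies in the extended reals, [ereal_inf] being [-oo] when
   the objective is unbounded below. *)
Definition optimal_value (R : realType) (T : Type) (feasible : set T)
    (objective : T -> R) : \bar R :=
  ereal_inf [set (objective t)%:E | t in feasible].

(* Main.v *)
(* Both problems range over the same set of Gram matrices.  A matrix [A']
   yields the map [x |-> A' (<x, psi_j>)_j], bounded by Cauchy-Schwarz.
   Conversely, given [A], an [A'] with [A' tphi_i = A phi_i] exists as soon as
   every linear relation between the [tphi_i] also holds between the [A phi_i];
   and a combination of the [phi_i] orthogonal to every [psi_j] lies in the
   span of the [psi_j], so it is orthogonal to itself and vanishes. *)
Require Import Defs.
From HB Require Import structures.
From mathcomp Require Import all_boot all_order all_algebra.
From mathcomp Require Import all_classical all_reals all_analysis.
From mathcomp Require Import lra.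

Set Implicit Arguments.
Unset Strict Implicit.
Unset Printing Implicit Defensive.

Import Order.TTheory GRing.Theory Num.Theory.
Import numFieldNormedType.Exports.

Local Open Scope classical_set_scope.
Local Open Scope ring_scope.

Lemma dotvE (R : realType) (d : nat) (u v : 'cV[R]_d) :
  dotv u v = (u^T *m v) 0 0.
Proof. by rewrite mxE; apply: eq_bigr => k _; rewrite mxE. Qed.

(** After squaring, each [v k 0 ^+ 2] is at most [|v k 0|] times the whole sum. *)
Lemma sqrt_dotv_le_sum (R : realType) (d : nat) (v : 'cV[R]_d) :
  Num.sqrt (dotv v v) <= \sum_(k < d) `|v k 0|.
Proof.
have sum_ge0 : 0 <= \sum_(k < d) `|v k 0| by exact: sumr_ge0.
rewrite -[leRHS]ger0_norm // -sqrtr_sqr ler_wsqrtr // expr2 mulr_suml.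
apply: ler_sum => k _; rewrite -expr2 -real_normK ?num_real // expr2.
by rewrite ler_wpM2l // (bigD1 k) //= lerDl sumr_ge0.
Qed.

Section InnerProduct.
Variables (R : realType) (X : completeNormedModType R) (ip : {dot X for idfun}).
Hypothesis ip_norm : induces_norm ip.

Lemma ipC (x y : X) : ip x y = ip y x.
Proof. by rewrite hermC /= expr0 mul1r. Qed.

Lemma ip_ge0 (x : X) : 0 <= ip x x.
Proof.
have [->|x0] := eqVneq x 0; first by rewrite linear0l.
exact/ltW/neq0_dnorm_gt0.
Qed.

Lemma ip_eq0 (x : X) : ip x x = 0 -> x = 0.
Proof. by move=> x0; apply/normr0_eq0; rewrite ip_norm x0 sqrtr0. Qed.

Lemma ipxx (x : X) : ip x x = `|x| ^+ 2.
Proof. by rewrite ip_norm sqr_sqrtr // ip_ge0. Qed.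

(* As the norm is already known to satisfy the triangle inequality, squaring
   the latter gives Cauchy-Schwarz. *)
Lemma ip_le (x y : X) : ip x y <= `|x| * `|y|.
Proof.
have : `|x + y| ^+ 2 <= (`|x| + `|y|) ^+ 2.
  by rewrite ler_sqr ?nnegrE ?addr_ge0 // ler_normD.
rewrite -ipxx linearDl !linearDr /= !ipxx (ipC y x); lra.
Qed.

Lemma normr_ip_le (x y : X) : `|ip x y| <= `|x| * `|y|.
Proof.
by rewrite ler_norml ip_le andbT lerNl -linearNl /= -[`|x|]normrN ip_le.
Qed.

Definition ip_vec (n : nat) (psi : 'I_n -> X) (x : X) : 'cV[R]_n :=
  \col_(j < n) ip x (psi j).

Definition mulmx_ip_vec (d n : nat) (A' : 'M[R]_(d, n)) (psi : 'I_n -> X)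
  (x : X) : 'cV[R]_d := A' *m ip_vec psi x.

Lemma mulmx_ip_vec_linear (d n : nat) (A' : 'M[R]_(d, n)) (psi : 'I_n -> X) :
  linear (mulmx_ip_vec A' psi).
Proof.
move=> a x y; rewrite /mulmx_ip_vec -linearP; congr (_ *m _).
by apply/colP => j; rewrite !mxE linearPl.
Qed.

HB.instance Definition _ (d n : nat) (A' : 'M[R]_(d, n)) (psi : 'I_n -> X) :=
  GRing.isLinear.Build R X 'cV[R]_d _ (mulmx_ip_vec A' psi)
    (mulmx_ip_vec_linear A' psi).

Lemma mulmx_ip_vec_bounded (d n : nat) (A' : 'M[R]_(d, n)) (psi : 'I_n -> X) :
  bounded_linear_map (mulmx_ip_vec A' psi).
Proof.
(* The constant comes from bounding the Euclidean norm by the sum of the absolute coordinates, then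
   using Cauchy-Schwarz on each [ip x (psi j)]. *)
exists (\sum_(k < d) \sum_(j < n) `|A' k j| * `|psi j|) => x.
apply: le_trans (sqrt_dotv_le_sum _) _; rewrite mulr_suml ler_sum // => k _.
rewrite mxE mulr_suml (le_trans (ler_norm_sum _ _ _)) // ler_sum // => j _.
by rewrite normrM -mulrA ler_wpM2l // mxE mulrC normr_ip_le.
Qed.

Lemma ip_span_eq0 (n : nat) (psi : 'I_n -> X) (x : X) :
  lin_span psi x -> ip_vec psi x = 0 -> x = 0.
Proof.
(* Expanding only the second argument of [ip x x] leaves the vanishing terms [ip x (psi j)]. *)
move=> [c xE] /colP x0; apply: ip_eq0; rewrite {2}xE linear_sumr big1 // => j _.
by have := x0 j; rewrite !mxE linearZr_LR /= => ->; rewrite mulr0.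
Qed.

Lemma linear_factors_ip_vec (d n : nat) (phi psi : 'I_n -> X)
    (A : {linear X -> 'cV[R]_d}) :
  lin_span phi `<=` lin_span psi ->
  exists A' : 'M[R]_(d, n), forall i, A (phi i) = A' *m ip_vec psi (phi i).
Proof.
move=> phi_psi.
(* The vectors to be matched are the columns of [B] and [T], so the goal reads [B = A' *m T], an
   inclusion of row spaces. *)
pose B := \matrix_(k < d, i < n) A (phi i) k 0.
pose T := \matrix_(j < n, i < n) ip (phi i) (psi j).
suff /submxP[A' BE] : (B <= T)%MS.
  exists A' => i; apply/colP => k.
  have /matrixP/(_ k i) := BE; rewrite !mxE => ->.
  by apply: eq_bigr => j _; rewrite !mxE.
(* The inclusion amounts to [B *m cokermx T = 0]; each column of [cokermx T] is a linear relation
   between the columns of [T]. *)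
rewrite submxE; apply/eqP/matrixP => k l.
move: (cokermx T) (mulmx_coker T) => K /matrixP TK0; rewrite !mxE.
pose x := \sum_(i < n) K i l *: phi i.
have x0 : x = 0.
  apply: (@ip_span_eq0 n psi); first by apply: phi_psi; exists (K^~ l).
  apply/colP => j; have := TK0 j l; rewrite !mxE => <-.
  rewrite linear_sumlz; apply: eq_bigr => i _.
  by rewrite linearZl_LR mxE mulrC.
(* Coordinate [k] of [A x] is the entry [(k, l)] of [B *m K]. *)
have /colP/(_ k) : A x = 0 by rewrite x0 linear0.
rewrite linear_sum summxE [RHS]mxE; apply: etrans.
by apply: eq_bigr => i _; rewrite linearZ !mxE mulrC.
Qed.

End InnerProduct.

Theorem theorem2 (R : realType) (X : completeNormedModType R)
    (ip : {dot X for idfun}) (ip_norm : induces_norm ip)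
    (X_sep : separable_space X)
    (d n : nat) (d_ge1 : (1 <= d)%N)
    (phi psi : 'I_n -> X)
    (span_eq : lin_span psi = lin_span phi)
    (f : 'M[R]_n -> R) :
  let tphi (i : 'I_n) : 'cV[R]_n := \col_(j < n) ip (phi i) (psi j) in
  optimal_value
    [set A : {linear X -> 'cV[R]_d} | bounded_linear_map A]
    (fun A : {linear X -> 'cV[R]_d} =>
       f (\matrix_(i < n, j < n) dotv (A (phi i)) (A (phi j))))
  = optimal_value
    [set: 'M[R]_(d, n)]
    (fun A' : 'M[R]_(d, n) =>
       f (\matrix_(i < n, j < n)
            ((tphi i)^T *m A'^T *m A' *m tphi j) 0 0)).
Proof.
(* Equality of the sets of objective values gives equal infima, attained or not. *)
move=> tphi; rewrite /optimal_value; congr ereal_inf.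
have gramE d' (A' : 'M[R]_(d', n)) (i j : 'I_n) :
    ((tphi i)^T *m A'^T *m A' *m tphi j) 0 0 =
    dotv (A' *m ip_vec ip psi (phi i)) (A' *m ip_vec ip psi (phi j)).
  by rewrite dotvE trmx_mul !mulmxA.
apply/seteqP; split => [_ [A _ <-]|_ [A' _ <-]] /=.
  have [|A' AE] := linear_factors_ip_vec ip_norm A (phi := phi) (psi := psi).
    by rewrite span_eq.
  exists A' => //; congr (f _)%:E.
  by apply/matrixP => i j; rewrite [LHS]mxE [RHS]mxE gramE !AE.
exists (mulmx_ip_vec ip A' psi); first exact: mulmx_ip_vec_bounded.
by congr (f _)%:E; apply/matrixP => i j; rewrite [LHS]mxE [RHS]mxE gramE.
Qed.
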